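(* Let $X$ be a random feature input, $A$ a random adjacency matrix and $\hat A$ a random estimate of $A$. Let $H_A$ and $H_{\hat A}$ be the hidden representations produced by a fixed graph neural network from $(A,X)$ and from $(\hat A,X)$ respectively. Let $Q$ be a measurable quantizer taking values in a finite set $\mathcal{H}$ with $2\le|\mathcal{H}|<\infty$, and put $\bar H_A=Q(H_A)$, $\bar H_{\hat A}=Q(H_{\hat A})$. For almost every $x$, define $P_e(x)=\mathbb{P}(\bar H_A\neq\bar H_{\hat A}\mid X=x)$. Then for almost every $x$, $$I(A;\hat A\mid X=x)\;\ge\; I(\bar H_A;\bar H_{\hat A}\mid X=x)\;\ge\; H(\bar H_A\mid X=x)-H_b\bigl(P_e(x)\bigr)-P_e(x)\log\bigl(|\mathcal{H}|-1\bigr).$$ Consequently the (weaker) bound obtained by replacing $\log(|\mathcal{H}|-1)$ with $\log|\mathcal{H}|$ also holds.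
   Context: The network has fixed parameters, so there is a fixed measurable map $h$ (a hidden layer of the network) with $H_A=h(A,X)$ and $H_{\hat A}=h(\hat A,X)$ (same layer for both). $A$ takes values in symmetric $\{0,1\}^{N\times N}$ matrices with zero diagonal, and $\hat A$ in symmetric $[0,1]^{N\times N}$ matrices with zero diagonal; $X$ takes values in $\mathbb{R}^{N\times D}$; $(A,\hat A,X)$ are jointly distributed on one probability space. $I(\cdot;\cdot\mid X=x)$ and $H(\cdot\mid X=x)$ denote mutual information and Shannon entropy computed under the (regular) conditional law given $X=x$. $H_b(p)=-p\log p-(1-p)\log(1-p)$ is the binary entropy; natural logarithms are used. *)

(* Defs.v *)
From HB Require Import structures.
From mathcomp Require Import all_boot all_order all_algebra.
From mathcomp Require Import all_classical all_reals all_analysis.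

Set Implicit Arguments.
Unset Strict Implicit.
Unset Printing Implicit Defensive.

Import Order.TTheory GRing.Theory Num.Theory.
Import numFieldNormedType.Exports.

Local Open Scope classical_set_scope.
Local Open Scope ring_scope.

(* Measurable types are pointed, so the discrete sigma-algebra on a finite
   type K needs an inhabitant: it is extracted from the cardinality bound. *)
Section alphabet.
Variables (K : finType) (hK : (2 <= #|K|)%N).

Definition alphabet of (2 <= #|K|)%N : Type := K.

HB.instance Definition _ := Finite.on (alphabet hK).

HB.instance Definition _ := isPointed.Build (alphabet hK)
  (enum_val (Ordinal (ltnW hK)) : K).

HB.instance Definition _ := @isMeasurable.Build default_measure_display
  (alphabet hK) discrete_measurable discrete_measurable0
  discrete_measurableC discrete_measurableU.

End alphabet.

HB.instance Definition _ (d1 d2 : measure_display) (T1 : measurableType d1)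
    (T2 : measurableType d2) :=
  isMeasurableFun.Build _ _ _ _ (@fst T1 T2) measurable_fst.

HB.instance Definition _ (d1 d2 : measure_display) (T1 : measurableType d1)
    (T2 : measurableType d2) :=
  isMeasurableFun.Build _ _ _ _ (@snd T1 T2) measurable_snd.

Section matrices.
Variable R : realType.

Definition borel_mx (m n : nat) := g_sigma_algebraType (@open 'M[R]_(m, n)).

Definition soft_adjacency (N : nat) : set (borel_mx N N) :=
  [set M : 'M[R]_N | [/\ M^T = M, forall i, M i i = 0 &
                        forall i j, 0 <= M i j <= 1]].

Definition hard_adjacency (N : nat) : set (borel_mx N N) :=
  [set M : 'M[R]_N | [/\ M^T = M, forall i, M i i = 0 &
                        forall i j, M i j = 0 \/ M i j = 1]].

End matrices.
Arguments soft_adjacency R N : clear implicits.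
Arguments hard_adjacency R N : clear implicits.

Section conditional_law.
Context {d dT dS : measure_display} {Omega : measurableType d}
  {T : measurableType dT} {S : measurableType dS} {R : realType}.
Local Open Scope ereal_scope.

(* k is a version of the regular conditional law of Y given X *)
Definition regular_cond_law (P : probability Omega R) (X : {RV P >-> T})
    (Y : Omega -> S) (k : R.-pker T ~> S) : Prop :=
  forall (B : set S) (C : set T), measurable B -> measurable C ->
    P (Y @^-1` B `&` X @^-1` C) = \int[distribution P X]_(x in C) k x B.

(* k x is only typed as a measure by the kernel structure *)
Definition law_at (k : R.-pker T ~> S) (x : T) : set S -> \bar R := k x.

HB.instance Definition _ (k : R.-pker T ~> S) (x : T) :=
  Measure.on (law_at k x).

HB.instance Definition _ (k : R.-pker T ~> S) (x : T) :=
  Measure_isProbability.Build _ _ _ (law_at k x) (prob_kernel (s := k) x).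

End conditional_law.

Section information.
Context {R : realType}.
Local Open Scope ereal_scope.
Local Open Scope charge_scope.

Definition kl_divergence {d : measure_display} {T : measurableType d}
    (p q : probability T R) : \bar R :=
  if `[< p `<< q >]
  then \int[p]_x lne (('d (charge_of_finite_measure p) '/d q) x)
  else +oo.

(* mutual information of the two coordinates under the joint law mu *)
Definition mutual_information {d1 d2 : measure_display}
    {T1 : measurableType d1} {T2 : measurableType d2}
    (mu : probability (T1 * T2)%type R) : \bar R :=
  kl_divergence mu (distribution mu (@fst T1 T2) \x distribution mu (@snd T1 T2)).

(* the convention 0 * log 0 = 0 is built in, since ln 0 = 0 *)
Definition shannon_entropy (K : finType) (hK : (2 <= #|K|)%N)
    (mu : probability (alphabet hK) R) : R :=
  (- \sum_(k : K) fine (mu [set (k : alphabet hK)]) *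
                  ln (fine (mu [set (k : alphabet hK)])))%R.

Definition binary_entropy (p : R) : R :=
  (- (p * ln p) - (1 - p) * ln (1 - p))%R.

End information.

(* Main.v *)
Require Import Defs.
From HB Require Import structures.
From mathcomp Require Import all_boot all_order all_algebra.
From mathcomp Require Import all_classical all_reals all_analysis.
From mathcomp Require Import measurable_realfun ring lra.

(* Everything follows from one variational bound: if c >= 0 has q-integral at
   most 1, then the p-integral of ln c is at most KL(p, q); integrate
   ln (c / r) <= c / r - 1 against p, where p = r q. With c the density of the
   image laws composed with the map, this is the data-processing inequality.
   With c (a, b) = W(a | b) / p(a), where W(. | b) gives mass 1 - Pe to b and
   is uniform elsewhere, it is Fano's inequality. Finally, for almost every x,
   kH x is the image of kA x under (a, b) |-> (Q (h (a, x)), Q (h (b, x))), by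
   disintegration of the joint law of (X, A, Ahat). *)

Set Implicit Arguments.
Unset Strict Implicit.
Unset Printing Implicit Defensive.

Import Order.TTheory GRing.Theory Num.Theory.
Import numFieldNormedType.Exports.

Local Open Scope classical_set_scope.
Local Open Scope ring_scope.
Local Open Scope ereal_scope.

(** * Kullback-Leibler divergence and its variational lower bound *)

Section divergence.
Context {R : realType} {d : measure_display} {T : measurableType d}.
Implicit Types p q : probability T R.
Local Open Scope charge_scope.

(** Positive parts increase and negative parts decrease, so the two are compared separately. No
    integrability is asked of [g], since the log-density it stands for later may have an infinite
    integral. *)
Lemma ae_le_integral (mu : {measure set T -> \bar R}) (f g : T -> \bar R) :
  measurable_fun [set: T] f -> measurable_fun [set: T] g ->
  {ae mu, forall x, f x <= g x} -> \int[mu]_x f x <= \int[mu]_x g x.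
Proof.
move=> mf mg fg; rewrite integralE [leRHS]integralE leeB//.
- apply: ae_ge0_le_integral => //; [exact: measurable_funepos..|].
  apply: filterS fg => x fgx _.
  by rewrite !funeposE ge_max !le_max lexx fgx orbT.
- apply: ae_ge0_le_integral => //; [exact: measurable_funeneg..|].
  apply: filterS fg => x fgx _.
  by rewrite !funenegE ge_max !le_max lexx leeN2 fgx orbT.
Qed.

Lemma measurable_lne_EFin (r : T -> R) :
  measurable_fun [set: T] r -> measurable_fun [set: T] (fun x => lne (r x)%:E).
Proof.
move=> mr; apply: measurable_fun_ifT => //; first exact: measurable_fun_ler.
by apply/measurable_EFinP; exact: measurableT_comp.
Qed.

(** Provides a density that is real-valued and non-negative at every point. It is positive
    [p]-almost everywhere because the [p]-mass of [r = 0] is the [q]-integral of [r] over that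
    set. *)
Lemma kl_divergenceP p q : p `<< q -> exists r : T -> R,
  [/\ measurable_fun [set: T] r, forall x, (0 <= r x)%R,
      {ae p, forall x, (0 < r x)%R},
      forall f : T -> R, measurable_fun [set: T] f -> (forall x, (0 <= f x)%R) ->
        \int[p]_x (f x)%:E = \int[q]_x (f x * r x)%:E &
      kl_divergence p q = \int[p]_x lne (r x)%:E].
Proof.
move=> pq; pose g := Radon_Nikodym_SigmaFinite.f p q.
have gfin x : g x \is a fin_num by exact: Radon_Nikodym_SigmaFinite.f_fin_num.
have g0 x : 0 <= g x by exact: Radon_Nikodym_SigmaFinite.f_ge0.
have mg : measurable_fun [set: T] g.
  exact/measurable_int/(Radon_Nikodym_SigmaFinite.f_integrable pq).
have mr : measurable_fun [set: T] (fine \o g) by exact: measurableT_comp.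
pose r := fine \o g.
have r0 x : (0 <= r x)%R by exact: fine_ge0.
have rE (f : T -> R) : measurable_fun [set: T] f -> (forall x, (0 <= f x)%R) ->
    \int[p]_x (f x)%:E = \int[q]_x (f x * r x)%:E.
  move=> mf f0.
  rewrite -(@Radon_Nikodym_SigmaFinite.change_of_variables _ _ _ _ _ pq)//.
  - by apply: eq_integral => x _; rewrite EFinM fineK.
  - exact/measurable_EFinP.
exists r; split => //.
- have mA : measurable [set x | r x = 0%R].
    by have := mr measurableT _ (measurable_set1 0%R); rewrite setTI.
  exists [set x | r x = 0%R]; split => //; last first.
    by move=> x /= /negP; rewrite -leNgt => rx; apply/eqP; rewrite eq_le rx r0.
  rewrite -[X in p X]setIT -integral_indic// rE//.
  rewrite integral0_eq// => x _; rewrite indicE.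
  by case: (boolP (x \in _)) => [|_]; rewrite ?mul0r// inE/= => ->; rewrite mulr0.
- rewrite /kl_divergence asboolT//; apply: ae_eq_integral => //.
  + rewrite (_ : (fun x => _) = (fun x =>
        lne (fine (('d (charge_of_finite_measure p) '/d q) x))%:E)).
      by apply: measurable_lne_EFin; exact: measurableT_comp.
    by apply/funext => x; congr lne; rewrite fineK// Radon_Nikodym_fin_num.
  + exact: measurable_lne_EFin.
  (* The two versions of the density agree [q]-almost everywhere, hence [p]-almost everywhere by
     domination. *)
  + have := null_dominates_ae_eq measurableT pq
      (ae_eq_Radon_Nikodym_SigmaFinite pq measurableT).
    by apply: filterS => x gx Dx; congr lne; rewrite -gx//= fineK.
Qed.

(** With [v = c / r], the [p]-integral of [v] is at most the [q]-integral of [c], hence at most 1.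
    Adding [1 - v] to [ln c] therefore does not decrease the integral, and the sum is pointwise at
    most [ln r]. *)
Lemma kl_divergence_ge p q (c : T -> R) :
  measurable_fun [set: T] c -> (forall x, (0 <= c x)%R) ->
  {ae p, forall x, (0 < c x)%R} -> \int[q]_x (c x)%:E <= 1 ->
  p.-integrable setT (EFin \o @ln R \o c) ->
  \int[p]_x (ln (c x))%:E <= kl_divergence p q.
Proof.
move=> mc c0 c_gt0 c1 ilnc.
have [pq|npq] := pselect (p `<< q); last first.
  by rewrite /kl_divergence asboolF// leey.
have [r [mr r0 r_gt0 rE ->]] := kl_divergenceP pq.
have mlner := measurable_lne_EFin mr.
pose v x : R := (c x / r x)%R.
have mv : measurable_fun [set: T] v.
  apply: measurable_funM => //.
  (* The inverse is written as a power with exponent -1, which is legitimate since [r >= 0]. *)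
  rewrite [X in measurable_fun _ X](_ : _ = (fun x => (r x) `^ (-1)))%R.
  exact: (measurableT_comp (measurable_powR (-1)%R) mr).
  by apply/funext => x; rewrite powR_inv1.
have v0 x : (0 <= v x)%R by rewrite divr_ge0.
have v1 : \int[p]_x (v x)%:E <= 1.
  rewrite rE//; apply: le_trans c1; apply: ge0_le_integral => //.
  - by move=> x _; rewrite lee_fin mulr_ge0.
  - by apply/measurable_EFinP; exact: measurable_funM.
  - exact/measurable_EFinP.
  (* Where [r] vanishes, [v * r] is 0 instead of [c]; hence an inequality only. *)
  - move=> x _; rewrite lee_fin /v; have [->|rx] := eqVneq (r x) 0%R.
      by rewrite mulr0.
    by rewrite divfK.
have iv : p.-integrable setT (EFin \o v).
  apply/integrableP; split; first exact/measurable_EFinP.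
  under eq_integral do rewrite /= ger0_norm//.
  by rewrite (le_lt_trans v1)// ltry.
have i1v : p.-integrable setT (fun x => 1 - (v x)%:E).
  by apply: integrableB => //; exact: finite_measure_integrable_cst.
apply: (@le_trans _ _ (\int[p]_x ((ln (c x))%:E + (1 - (v x)%:E)))).
  rewrite integralD//; rewrite leeDl// integralB//; last first.
    exact: finite_measure_integrable_cst.
  rewrite integral_cst// mul1e [X in X - _](_ : _ = 1) ?sube_ge0// ?orbT//.
  exact: probability_setT.
apply: ae_le_integral => //.
  by apply: emeasurable_funD; [exact: measurable_int ilnc|exact: measurable_int i1v].
apply: filterS2 c_gt0 r_gt0 => x cx rx.
rewrite lne_EFin// -EFinB -EFinD lee_fin.
(* [ln (c / r) <= c / r - 1] *)
have := @le_ln1Dx R (v x - 1)%R.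
rewrite [(1 + _)%R]addrC subrK ltrBrDl subrr => /(_ (divr_gt0 cx rx)).
rewrite ln_div ?posrE// => vx.
by move: vx; rewrite /v; lra.
Qed.

End divergence.

(** * Data processing for maps into finite discrete spaces *)

Section finite_codomain.
Context {R : realType} {d' : measure_display} {T' : measurableType d'}.
Hypothesis mT' : forall B : set T', measurable B.
Variable s : seq T'.
Hypothesis memT' : forall x, x \in s.

Lemma integral_finite_type (mu : probability T' R) (f : T' -> R) : uniq s ->
  \int[mu]_x (f x)%:E = (\sum_(y <- s) f y * fine (mu [set y]))%:E.
Proof.
move=> us.
have fE x : (f x)%:E = \sum_(y <- s) ((f y)%:E * (\1_[set y] x)%:E).
  rewrite (bigD1_seq x)//= indicE mem_set// mule1 big1_seq ?adde0//.
  move=> y /andP[yx _]; rewrite indicE memNset ?mule0//= => xy.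
  by rewrite xy eqxx in yx.
have i1 y : mu.-integrable [set: T'] (fun x => (\1_[set y] x)%:E).
  exact: integrable_indic.
under eq_integral do rewrite fE.
rewrite integral_sum//; last by move=> y; exact: integrableZl.
rewrite -sumEFin; apply: eq_bigr => y _.
rewrite integralZl// integral_indic// setIT EFinM fineK//.
exact: fin_num_measure.
Qed.

(** Take [c = r \o F] with [r] the density of [p'] with respect to [q']: its [q]-integral is the
    total mass of [p'], and the [p]-integral of its logarithm is the divergence of the images. The
    image laws enter through equations on sets, so that product measures and values of kernels fit
    directly. *)
Lemma kl_divergence_image {d : measure_display} {T : measurableType d}
    (p q : probability T R) (F : {mfun T >-> T'}) (p' q' : probability T' R) :
  (forall B, p' B = p (F @^-1` B)) -> (forall B, q' B = q (F @^-1` B)) ->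
  kl_divergence p' q' <= kl_divergence p q.
Proof.
move=> p'E q'E.
have [pq|npq] := pselect (p `<< q); last first.
  by rewrite {2}/kl_divergence asboolF// leey.
have mF B : measurable (F @^-1` B).
  by rewrite -[X in measurable X]setTI; exact: measurable_funP.
have p'q' : p' `<< q'.
  apply/null_content_dominatesP => B mB; rewrite [LHS]q'E => qB.
  by rewrite p'E; move/null_content_dominatesP : pq; exact.
have [r [_ r0 r_gt0 rE ->]] := kl_divergenceP p'q'.
have mfun (g : T' -> R) : measurable_fun [set: T'] g by [].
have mfunF (g : T' -> R) : measurable_fun [set: T] (g \o F).
  by apply: measurableT_comp.
have -> : \int[p']_x lne (r x)%:E = \int[p']_x (ln (r x))%:E.
  apply: ae_eq_integral => //.
  by apply: filterS r_gt0 => x rx _; rewrite lne_EFin.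
have intF : p.-integrable [set: T] (EFin \o @ln R \o (r \o F)).
  apply: measurable_bounded_integrable => //.
  - by rewrite (le_lt_trans (probability_le1 _ _))// ltry.
  - exact: (mfunF (@ln R \o r)).
  (* Finiteness of the codomain bounds [ln \o r] by the sum of all its absolute values. *)
  exists (\sum_(y <- s) `|ln (r y)|)%R; split; first exact: num_real.
  move=> M /ltW sM x _; apply: le_trans sM => /=.
  by rewrite (big_rem (F x))//= lerDl sumr_ge0.
have -> : \int[p']_x (ln (r x))%:E = \int[p]_x (ln ((r \o F) x))%:E.
  rewrite (eq_measure_integral (pushforward p F)); last by move=> B _ _; exact: p'E.
  by rewrite integral_pushforward.
apply: kl_divergence_ge => //.
- by move=> x; exact: r0.
- case: r_gt0 => B [mB pB rB]; exists (F @^-1` B); split => //.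
    by rewrite -p'E.
  by move=> x /= /rB.
- rewrite -(_ : \int[q']_x (r x)%:E = \int[q]_x ((r \o F) x)%:E); last first.
    rewrite (eq_measure_integral (pushforward q F)); last by move=> B _ _; exact: q'E.
    by rewrite ge0_integral_pushforward// => x _; rewrite lee_fin.
  rewrite (_ : \int[q']_x (r x)%:E = \int[p']_x cst 1 x).
    by rewrite integral_cst// mul1e probability_le1.
  by rewrite [RHS](rE (cst 1%R))//; apply: eq_integral => x _; rewrite mul1r.
Qed.

End finite_codomain.

(** A map acting coordinatewise sends the product of the marginals of [mu] to the product of the
    marginals of [mu'], so both arguments of the divergence are images under the same map. *)
Lemma mutual_information_image {R : realType} {d1 d2 d1' d2' : measure_display}
    {T1 : measurableType d1} {T2 : measurableType d2}
    {T1' : measurableType d1'} {T2' : measurableType d2'}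
    (s : seq (T1' * T2')) (f1 : {mfun T1 >-> T1'}) (f2 : {mfun T2 >-> T2'})
    (mu : probability (T1 * T2)%type R) (mu' : probability (T1' * T2')%type R) :
  (forall B : set (T1' * T2'), measurable B) -> (forall x, x \in s) ->
  (forall B, mu' B = mu ((fun x => (f1 x.1, f2 x.2)) @^-1` B)) ->
  mutual_information mu' <= mutual_information mu.
Proof.
move=> mT' memT' mu'E.
have mF : measurable_fun [set: T1 * T2] (fun x => (f1 x.1, f2 x.2)).
  by apply: measurable_fun_pair => //; exact: measurableT_comp.
pose F := mfun_Sub (mem_set mF : (fun x => (f1 x.1, f2 x.2)) \in mfun).
apply: (@kl_divergence_image _ _ _ mT' s memT' _ _ _ _ F) => // B.
(* It suffices to compare the two measures on rectangles, whose preimages are again rectangles. *)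
apply: (@product_measure_unique _ _ _ _ _ (distribution mu' fst)
  (distribution mu' snd) (pushforward _ F)) => // B1 B2 mB1 mB2.
rewrite /= /pushforward /=.
rewrite (_ : _ @^-1` _ = (f1 @^-1` B1) `*` (f2 @^-1` B2))//.
rewrite product_measure1E//.
- by rewrite /distribution /pushforward !mu'E.
- by rewrite -[X in measurable X]setTI; exact: measurable_funP.
- by rewrite -[X in measurable X]setTI; exact: measurable_funP.
Qed.

(** The pair type carries the product sigma-algebra, not the discrete one by definition; every set
    is a finite union of one-point rectangles. *)
Lemma measurable_alphabetX (K K' : finType) (hK : (2 <= #|K|)%N)
    (hK' : (2 <= #|K'|)%N) (B : set (alphabet hK * alphabet hK')) :
  measurable B.
Proof.
rewrite (_ : B = \bigcup_(x in B) ([set x.1] `*` [set x.2])).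
  apply: fin_bigcup_measurable => [|x _]; first exact: finite_finset.
  exact: measurableX.
by apply/seteqP; split=> [x Bx|[x1 x2] [[y1 y2] By [/= -> ->]]//]; exists x.
Qed.

(** * Fano's inequality for a finite joint mass function *)

Section fano.
Local Open Scope ring_scope.
Context {R : realType} {K : finType}.
Hypothesis K_gt1 : (1 < #|K|)%N.
Variable m : K -> K -> R.
Hypotheses (m_ge0 : forall a b, 0 <= m a b) (m_sum1 : \sum_a \sum_b m a b = 1).

Definition marginal1 a := \sum_b m a b.
Definition marginal2 b := \sum_a m a b.
Definition mismatch := \sum_a \sum_b (a != b)%:R * m a b.
Local Notation n1 := (#|K|%:R - 1 : R).
Local Notation pA := marginal1.
Local Notation pB := marginal2.
Local Notation Pe := mismatch.

(* For each [b], [fano_weight ^~ b] is the law of [a] for which an error of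
   probability [Pe] is uniform over the [#|K| - 1] wrong symbols. *)
Definition fano_weight (a b : K) := if a == b then 1 - Pe else Pe / n1.

(** Density, relative to [pA] times [pB], of the joint law with second marginal [pB] and conditional
    law [fano_weight]. It is 0 where [pA a = 0], by the convention on division. *)
Definition fano_density a b := fano_weight a b / pA a.

Let n1_gt0 : 0 < n1.
Proof. by rewrite subr_gt0 ltr1n. Qed.

Let le_m_pA a b : m a b <= pA a.
Proof. by rewrite /marginal1 (bigD1 b)//= lerDl sumr_ge0. Qed.

Let Pe_ge0 : 0 <= Pe.
Proof. by apply: sumr_ge0 => a _; apply: sumr_ge0 => b _; rewrite mulr_ge0. Qed.

Let correctE : 1 - Pe = \sum_a m a a.
Proof.
rewrite -m_sum1 /mismatch -sumrB; apply: eq_bigr => a _.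
rewrite -sumrB (bigD1 a)//= eqxx mul0r subr0 big1 ?addr0// => b ba.
by rewrite eq_sym ba mul1r subrr.
Qed.

Let Pe_le1 : Pe <= 1.
Proof. by rewrite -subr_ge0 correctE sumr_ge0. Qed.

Let fano_weight_ge0 a b : 0 <= fano_weight a b.
Proof.
by rewrite /fano_weight; case: ifP => _; rewrite ?subr_ge0// divr_ge0// ltW.
Qed.

(** A diagonal atom contributes to [1 - Pe] and an off-diagonal one to [Pe], so a weight can vanish
    only where [m] does. *)
Let fano_weight_gt0 a b : 0 < m a b -> 0 < fano_weight a b.
Proof.
rewrite /fano_weight; case: eqVneq => [<-|ab] mab.
  by rewrite correctE (bigD1 a)//= ltr_pwDl// sumr_ge0.
rewrite divr_gt0// /mismatch (bigD1 a)//= ltr_pwDl//.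
  by rewrite (bigD1 b)//= ab mul1r ltr_pwDl// sumr_ge0// => ? _; rewrite mulr_ge0.
by apply: sumr_ge0 => ? _; apply: sumr_ge0 => ? _; rewrite mulr_ge0.
Qed.

Let sum_fano_weight b : \sum_a fano_weight a b = 1.
Proof.
rewrite (bigD1 b)//= {1}/fano_weight eqxx.
rewrite (eq_bigr (fun=> Pe / n1)); last first.
  by move=> a /negbTE ab; rewrite /fano_weight ab.
(* The wrong symbols form the complement of [b], of cardinality [#|K| - 1]. *)
rewrite sumr_const -[X in _ *+ X]/(#|predC1 b|) cardC1 -[X in _ + X]mulr_natr.
by rewrite -subn1 natrB ?(ltnW K_gt1)// divfK ?subrK// gt_eqF.
Qed.

Lemma fano_density_gt0 a b : 0 < m a b -> 0 < fano_density a b.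
Proof.
by move=> mab; rewrite divr_gt0 ?fano_weight_gt0// (lt_le_trans mab).
Qed.

Lemma fano_density_ge0 a b : 0 <= fano_density a b.
Proof. by rewrite divr_ge0// sumr_ge0. Qed.

(** For fixed [b], [pA a] cancels and the weights sum to 1, leaving [pB b]. Terms with [pA a = 0]
    are lost, hence [<=]. *)
Lemma fano_density_mass :
  \sum_a \sum_b fano_density a b * (pA a * pB b) <= 1.
Proof.
rewrite -m_sum1 [leRHS]exchange_big [leLHS]exchange_big/=; apply: ler_sum => b _.
rewrite -/(marginal2 b) -[leRHS]mul1r -(sum_fano_weight b) mulr_suml.
apply: ler_sum => a _; rewrite /fano_density; have [->|pA0] := eqVneq (pA a) 0.
  by rewrite mul0r mulr0 mulr_ge0// sumr_ge0.
by rewrite mulrA divfK.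
Qed.

(** On the support of [m] the logarithm splits into [ln (1 - Pe)] or [ln (Pe / n1)], minus
    [ln (pA a)]; these are collected with total weights [1 - Pe], [Pe] and [pA a]. *)
Lemma fano_density_ln : \sum_a \sum_b ln (fano_density a b) * m a b =
  - (\sum_a pA a * ln (pA a)) - binary_entropy Pe - Pe * ln n1.
Proof.
have lnE a b : ln (fano_density a b) * m a b =
    ln (1 - Pe) * (m a b - (a != b)%:R * m a b) +
    ln (Pe / n1) * ((a != b)%:R * m a b) - ln (pA a) * m a b.
  have [->|mab] := eqVneq (m a b) 0; first by rewrite !(mulr0, subr0, addr0).
  have {}mab : 0 < m a b by rewrite lt_neqAle eq_sym mab m_ge0.
  rewrite /fano_density [ln (_ / pA a)]ln_div ?posrE ?fano_weight_gt0// ?(lt_le_trans mab)//.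
  rewrite /fano_weight; case: (a == b) => /=; ring.
under eq_bigr do under eq_bigr do rewrite lnE.
under eq_bigr do rewrite sumrB big_split/= -!mulr_sumr sumrB.
rewrite sumrB big_split/= -!mulr_sumr sumrB m_sum1 -/mismatch.
rewrite (eq_bigr (fun a => pA a * ln (pA a))); last first.
  by move=> a _; rewrite mulrC.
(* The quotient inside the logarithm splits only for [Pe > 0]; at [Pe = 0] its coefficient is 0. *)
rewrite /binary_entropy; have [->|Pe0] := eqVneq Pe 0; first by ring.
rewrite ln_div ?posrE//; last by rewrite lt_neqAle eq_sym Pe0.
by ring.
Qed.

End fano.

(** * Fano's inequality for a probability measure on pairs of symbols *)

Section fano_inequality.
Context {R : realType} {K : finType}.
Variable hK : (2 <= #|K|)%N.
Local Notation A := (alphabet hK).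
Variable mu : probability (A * A)%type R.

(** [alphabet hK] is a copy of [K]; the identity carries cardinals and sums from one to the
    other. *)
Let id_bij : bijective (id : A -> K).
Proof. by exists id. Qed.

Let card_AK : #|{: A}| = #|K|.
Proof. exact: bij_eq_card id_bij. Qed.

Let card_A : (1 < #|{: A}|)%N.
Proof. by rewrite card_AK. Qed.

Let mAA (B : set (A * A)) : measurable B.
Proof. exact: measurable_alphabetX. Qed.

Let m (a b : A) : R := fine (mu [set (a, b)]).

Let fine_mu (B : set (A * A)) :
  fine (mu B) = (\sum_a \sum_b \1_B (a, b) * m a b)%R.
Proof.
rewrite pair_bigA -[B in LHS]setIT -integral_indic//.
rewrite (integral_finite_type mAA (s := index_enum (A * A)%type))//=.
- by apply: eq_bigr => -[a b] _.
- by move=> x; rewrite mem_index_enum.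
- exact: index_enum_uniq.
Qed.

Let m_ge0 a b : (0 <= m a b)%R.
Proof. exact: fine_ge0. Qed.

Let m_sum1 : (\sum_a \sum_b m a b = 1)%R.
Proof.
transitivity (fine (mu setT)); last by rewrite probability_setT.
rewrite fine_mu; apply: eq_bigr => a _; apply: eq_bigr => b _.
by rewrite indicT mul1r.
Qed.

Let marginal1E a : fine (distribution mu fst [set a]) = marginal1 m a.
Proof.
rewrite /distribution /pushforward fine_mu /marginal1 (bigD1 a)//=.
rewrite [X in (_ + X)%R]big1 ?addr0 => [|a' a'a].
  by apply: eq_bigr => b _; rewrite indicE mem_set// mul1r.
apply: big1 => b _; rewrite indicE memNset ?mul0r//= => a'E.
by rewrite a'E eqxx in a'a.
Qed.

Let marginal2E b : fine (distribution mu snd [set b]) = marginal2 m b.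
Proof.
rewrite /distribution /pushforward fine_mu /marginal2; apply: eq_bigr => a _.
rewrite (bigD1 b)//= indicE mem_set// mul1r big1 ?addr0// => b' b'b.
rewrite indicE memNset ?mul0r//= => b'E.
by rewrite b'E eqxx in b'b.
Qed.

Let mismatchE : fine (mu [set ab | ab.1 <> ab.2]) = mismatch m.
Proof.
rewrite fine_mu; apply: eq_bigr => a _; apply: eq_bigr => b _.
rewrite indicE; congr ((nat_of_bool _)%:R * _)%R.
by apply/idP/idP => [/set_mem/eqP //|/eqP ab]; exact: mem_set.
Qed.

Lemma fano_mutual_information (Pe := fine (mu [set ab | ab.1 <> ab.2])) :
  (shannon_entropy (distribution mu fst) - binary_entropy Pe -
     Pe * ln (#|K|%:R - 1))%:E <= mutual_information mu.
Proof.
have sAA x : x \in index_enum (A * A)%type by rewrite mem_index_enum.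
have uAA : uniq (index_enum (A * A)%type) by exact: index_enum_uniq.
pose c (x : A * A) := fano_density m x.1 x.2.
have c_ge0 x : (0 <= c x)%R by exact: (fano_density_ge0 card_A m_ge0 m_sum1).
have mfun (f : A * A -> R) : measurable_fun [set: A * A] f by [].
(* The lower bound is exactly the [mu]-integral of [ln c], so the variational bound applies with [c]
   as test function. *)
rewrite (_ : _%:E = \int[mu]_x (ln (c x))%:E); last first.
  rewrite (integral_finite_type mAA sAA)// /Pe mismatchE; congr (_%:E).
  transitivity (\sum_a \sum_b ln (fano_density m a b) * m a b)%R.
    rewrite (fano_density_ln card_A)// card_AK; congr (- _ - _ - _)%R.
    rewrite (reindex (id : A -> K)) /=; last exact: onW_bij.
    by apply: eq_bigr => a _; rewrite marginal1E.
  by rewrite pair_bigA; apply: eq_bigr => -[a b] _.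
apply: kl_divergence_ge => //.
(* The exceptional set consists of the points of mass zero; it is null because there are finitely
   many. *)
- exists [set x | mu [set x] = 0]; split => //.
    rewrite -[LHS]fineK ?fin_num_measure//; congr (_%:E).
    rewrite fine_mu big1// => a _; rewrite big1// => b _; rewrite indicE /m.
    by case: (boolP (_ \in _)) => [|_]; rewrite ?mul0r// inE/= => ->; rewrite mulr0.
  move=> [a b] /= cab; rewrite -[LHS]fineK ?fin_num_measure//; congr (_%:E).
  apply/eqP; rewrite eq_le fine_ge0// andbT leNgt; apply/negP => mab.
  exact: cab (fano_density_gt0 card_A m_ge0 m_sum1 mab).
- rewrite (integral_finite_type mAA sAA)//= lee_fin.
  apply: le_trans (fano_density_mass card_A m_ge0 m_sum1).
  rewrite pair_bigA le_eqVlt; apply/orP; left; apply/eqP.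
  apply: eq_bigr => -[a b] _; congr (_ * _)%R; rewrite -marginal1E -marginal2E.
  rewrite -fineM ?fin_num_measure//; congr fine.
  rewrite (_ : [set (a, b)] = [set a] `*` [set b]); first exact: product_measure1E.
  by apply/seteqP; split => -[x y] /= [-> ->].
- apply: measurable_bounded_integrable => //.
    by rewrite (le_lt_trans (probability_le1 _ _))// ltry.
  exists (\sum_x `|ln (c x)|)%R; split; first exact: num_real.
  by move=> M /ltW sM x _; apply: le_trans sM; rewrite /= (bigD1 x)//= lerDl sumr_ge0.
Qed.

End fano_inequality.

(** * Disintegration and images of regular conditional laws *)

Section conditional_law.
Context {d dT dS : measure_display} {Omega : measurableType d}
  {T : measurableType dT} {S : measurableType dS} {R : realType}.
Variables (P : probability Omega R) (X : {RV P >-> T}).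
Variables (Y : {mfun Omega >-> S}) (k : R.-pker T ~> S).
Hypothesis kY : regular_cond_law X Y k.

Let measurable_section_kernel (E : set (T * S)) : measurable E ->
  measurable_fun [set: T] (fun x => k x (xsection E x)).
Proof. by move=> mE; apply: measurable_fun_xsection_finite_kernel; rewrite inE. Qed.

(** The hypothesis [kY] is this formula on rectangles. Rectangles form a pi-system generating the
    product sigma-algebra, and the sets satisfying the formula form a Dynkin system. *)
Lemma regular_cond_law_xsection (E : set (T * S)) : measurable E ->
  P ((fun w => (X w, Y w)) @^-1` E) =
    \int[distribution P X]_x k x (xsection E x).
Proof.
have mXY : measurable_fun [set: Omega] (fun w => (X w, Y w)).
  by apply: measurable_fun_pair; exact: measurable_funP.
have mpre (F : set (T * S)) : measurable F ->
    measurable ((fun w => (X w, Y w)) @^-1` F).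
  by move=> mF; rewrite -[X in measurable X]setTI; exact: mXY.
pose C := [set A `*` B | A in @measurable _ T & B in @measurable _ S].
pose good (F : set (T * S)) := P ((fun w => (X w, Y w)) @^-1` F) =
  \int[distribution P X]_x k x (xsection F x).
have Cgood : C `<=` good.
  move=> _ [A mA [B mB <-]]; rewrite /good.
  rewrite (_ : _ @^-1` _ = Y @^-1` B `&` X @^-1` A); last first.
    by apply/seteqP; split=> w [].
  (* The section of a rectangle is its second side over [A] and empty elsewhere. *)
  rewrite kY// integral_mkcond; apply: eq_integral => x _.
  rewrite patchE; case: ifPn => xA; first by rewrite in_xsectionX.
  by rewrite notin_xsectionX// measure0.
have CE : @measurable _ (T * S)%type = <<s C >>.
  exact: measurable_prod_measurableType.
rewrite {1}CE; apply: (@dynkin_induction _ _ C good CE) => //.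
- move=> _ _ [X1 mX1 [X2 mX2 <-]] [Y1 mY1 [Y2 mY2 <-]].
  exists (X1 `&` Y1); first exact: measurableI.
  by exists (X2 `&` Y2); [exact: measurableI|rewrite setXI].
- by apply: Cgood; exists setT => //; exists setT => //; rewrite setXTT.
- move=> F mF gF; rewrite /good -preimage_setC probability_setC; last exact: mpre.
  have mk := measurable_section_kernel mF.
  rewrite gF [RHS](eq_integral (fun x => 1 - k x (xsection F x))); last first.
    move=> x _; rewrite !xsectionE -preimage_setC -xsectionE.
    exact: (@probability_setC _ _ _ (law_at k x) _ (measurable_xsection _ mF)).
  rewrite integralB//.
  + rewrite integral_cst// mul1e [X in _ = X - _](_ : _ = 1)//.
    exact: (@probability_setT _ _ _ (distribution P X)).
  + exact: finite_measure_integrable_cst.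
  + apply: (@le_integrable _ _ _ _ _ measurableT _ (cst 1)) => //.
      move=> x _; rewrite /= normr1 gee0_abs//.
      exact: (@probability_le1 _ _ _ (law_at k x) _ (measurable_xsection _ mF)).
    exact: finite_measure_integrable_cst.
- move=> F mF tF gF; rewrite /good preimage_bigcup measure_bigcup//=; last 2 first.
    by move=> n _; exact: mpre.
    apply/trivIsetP => i j _ _ ij; rewrite -preimage_setI.
    by move/trivIsetP : tF => -> //; rewrite preimage_set0.
  rewrite [RHS](eq_integral (fun x => \sum_(n <oo) k x (xsection (F n) x))); last first.
    move=> x _; rewrite xsection_bigcup measure_bigcup//; last 2 first.
      by move=> n _; exact: measurable_xsection.
      exact: trivIset_xsection.
    by apply: eq_eseriesl => n; rewrite in_setT.
  rewrite integral_nneseries//; last by move=> n; exact: measurable_section_kernel.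
  transitivity (\sum_(n <oo) P ((fun w => (X w, Y w)) @^-1` F n)).
    by apply: eq_eseriesl => n; rewrite in_setT.
  by apply: eq_eseriesr => n _; exact: gF.
Qed.

(** Over every measurable set of values of [X], both sides have the same integral, namely a joint
    probability; hence they agree almost everywhere. The null set depends on [B]. *)
Lemma regular_cond_law_map {dS' : measure_display} {S' : measurableType dS'}
    (G : T * S -> S') (k' : R.-pker T ~> S') (B : set S') :
  measurable_fun [set: T * S] G ->
  regular_cond_law X (fun w => G (X w, Y w)) k' -> measurable B ->
  {ae distribution P X, forall x, k' x B = k x ((fun y => G (x, y)) @^-1` B)}.
Proof.
move=> mG k'G mB.
have mGB : measurable (G @^-1` B) by rewrite -[X in measurable X]setTI; exact: mG.
have mk' : measurable_fun [set: T] (k' ^~ B) by exact: measurable_kernel.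
have : ae_eq (distribution P X) setT (k' ^~ B)
    (fun x => k x (xsection (G @^-1` B) x)).
  apply: integral_ae_eq => //.
  - apply: (@le_integrable _ _ _ _ _ measurableT _ (cst 1)) => //.
      move=> x _; rewrite /= normr1 gee0_abs//.
      exact: (@probability_le1 _ _ _ (law_at k' x) _ mB).
    exact: finite_measure_integrable_cst.
  - exact: measurable_section_kernel.
  - move=> E _ mE; rewrite -k'G//.
    have mGE : measurable (G @^-1` B `&` E `*` setT).
      by apply: measurableI => //; exact: measurableX.
    rewrite (_ : _ `&` _ = (fun w => (X w, Y w)) @^-1` (G @^-1` B `&` E `*` setT)).
      rewrite regular_cond_law_xsection// [RHS]integral_mkcond.
      apply: eq_integral => x _; rewrite patchE xsectionI.
      case: ifPn => xE; first by rewrite in_xsectionX// setIT.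
      by rewrite notin_xsectionX// setI0 measure0.
    by apply/seteqP; split=> [w [GB XE]|w [GB [XE _]]].
by apply: filterS => x /(_ I) ->; rewrite xsectionE.
Qed.

End conditional_law.

(** * Measurability of the adjacency domain, and the theorem *)

Lemma measurable_soft_adjacency (R : realType) (N : nat) :
  measurable (soft_adjacency R N).
Proof.
have closed_measurable (A : set (borel_mx R N N)) :
    closed (A : set 'M[R]_N) -> measurable A.
  move=> cA; rewrite -[A]setCK; apply: measurableC.
  by apply: sub_sigma_algebra; exact: closed_openC.
pose entry i j (M : 'M[R]_N) := M i j.
have centry i j : continuous (entry i j) by exact: coord_continuous.
(* Symmetry, zero diagonal and range are closed conditions on the continuous entries, so the set is
   closed, hence Borel. *)
rewrite (_ : soft_adjacency R N =
    (\bigcap_(i in [set: 'I_N]) \bigcap_(j in [set: 'I_N])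
       [set M | entry j i M = entry i j M]) `&`
    (\bigcap_(i in [set: 'I_N]) entry i i @^-1` [set 0%R]) `&`
    (\bigcap_(i in [set: 'I_N]) \bigcap_(j in [set: 'I_N])
       entry i j @^-1` [set` `[0%R, 1%R]])).
  apply: closed_measurable; apply: closedI; first apply: closedI.
  - apply: closed_bigI => i _; apply: closed_bigI => j _.
    rewrite (_ : [set _ | _] =
        (fun M => entry j i M - entry i j M)%R @^-1` [set 0%R]).
      apply: closed_comp; last exact: closed_eq.
      by move=> M _; apply: continuousB; exact: centry.
    apply/seteqP; split=> [M /= ->|M /= /eqP]; first by rewrite subrr.
    by rewrite subr_eq0 => /eqP.
  - apply: closed_bigI => i _; apply: closed_comp; last exact: closed_eq.
    by move=> M _; exact: centry.
  - apply: closed_bigI => i _; apply: closed_bigI => j _.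
    apply: closed_comp; last exact: interval_closed.
    by move=> M _; exact: centry.
apply/seteqP; split=> [M [symM M0 M01]|M [[symM M0] M01]].
  split; first split.
  - by move=> i _ j _ /=; rewrite /entry -[in LHS]symM mxE.
  - by move=> i _ /=; exact: M0.
  - by move=> i _ j _ /=; rewrite in_itv/=; exact: M01.
split.
- by apply/matrixP => i j; rewrite mxE; exact: symM.
- by move=> i; exact: M0.
- by move=> i j; have := M01 i I j I; rewrite /= in_itv.
Qed.

Theorem theorem9
  (R : realType) (N D : nat)
  (d : measure_display) (Omega : measurableType d) (P : probability Omega R)
  (A Ahat : {RV P >-> borel_mx R N N}) (X : {RV P >-> borel_mx R N D})
  (A_hard : forall w, hard_adjacency R N (A w))
  (Ahat_soft : forall w, soft_adjacency R N (Ahat w))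
  (dH : measure_display) (Hidden : measurableType dH)
  (h : borel_mx R N N * borel_mx R N D -> Hidden)
  (mh : measurable_fun (soft_adjacency R N `*` [set: borel_mx R N D]) h)
  (K : finType) (hK : (2 <= #|K|)%N) (Q : {mfun Hidden >-> alphabet hK})
  (kA : R.-pker (borel_mx R N D) ~> (borel_mx R N N * borel_mx R N N)%type)
  (kA_cond : regular_cond_law X (fun w => (A w, Ahat w)) kA)
  (kH : R.-pker (borel_mx R N D) ~> (alphabet hK * alphabet hK)%type)
  (kH_cond : regular_cond_law X
     (fun w => (Q (h (A w, X w)), Q (h (Ahat w, X w)))) kH) :
  {ae distribution P X, forall x,
    let Pe := fine (law_at kH x [set ab | ab.1 <> ab.2]) in
    let HA := shannon_entropy (distribution (law_at kH x) fst) in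
    [/\ mutual_information (law_at kA x) >= mutual_information (law_at kH x),
        mutual_information (law_at kH x) >=
          (HA - binary_entropy Pe - Pe * ln (#|K|%:R - 1))%:E &
        mutual_information (law_at kH x) >=
          (HA - binary_entropy Pe - Pe * ln #|K|%:R)%:E ]}.
Proof.
have hs a : hard_adjacency R N a -> soft_adjacency R N a.
  move=> [symM M0 M01]; split=> // i j.
  by case: (M01 i j) => ->; rewrite ?lexx ler01.
pose dom := soft_adjacency R N `*` [set: borel_mx R N D].
have mdom : measurable dom.
  by apply: measurableX => //; exact: measurable_soft_adjacency.
(* [h] is only measurable on [dom], so [Q \o h] is extended by a constant. *)
pose g ax : alphabet hK := if ax \in dom then Q (h ax) else point.
have mg : measurable_fun setT g.
  apply: measurable_fun_if => //.
  - apply: (measurable_fun_bool true); rewrite setTI.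
    rewrite (_ : _ @^-1` _ = dom)//.
    by apply/seteqP; split=> z; [exact: set_mem|exact: mem_set].
  - apply: (measurable_comp (F := setT)) => //.
    by apply: measurable_funS mh => // ax [_ /set_mem].
have mY : measurable_fun setT (fun w => (A w, Ahat w)).
  by apply: measurable_fun_pair; exact: measurable_funP.
pose Y := mfun_Sub (mem_set mY : (fun w => (A w, Ahat w)) \in mfun).
pose G (z : borel_mx R N D * (borel_mx R N N * borel_mx R N N)) :=
  (g (z.2.1, z.1), g (z.2.2, z.1)).
have mG : measurable_fun setT G.
  apply: measurable_fun_pair; apply: (measurableT_comp mg);
    by apply: measurable_fun_pair => //; exact: measurableT_comp.
(* Both [A] and [Ahat] stay in [dom], so the constant extension is never seen along the random
   variables. *)
have GE w : G (X w, Y w) = (Q (h (A w, X w)), Q (h (Ahat w, X w))).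
  have mA : (A w, X w) \in dom by apply: mem_set; split=> //; exact/hs/A_hard.
  have mAhat : (Ahat w, X w) \in dom.
    by apply: mem_set; split=> //; exact: Ahat_soft.
  by rewrite /G /g /= mA mAhat.
have kH_G : regular_cond_law X (fun w => G (X w, Y w)) kH.
  by rewrite (funext GE).
(* The alphabet being finite, there are finitely many sets [B]; indexing them by a finite type
   yields one null set valid for all of them. *)
have kHE : {ae distribution P X, forall x, forall B : set (alphabet hK * alphabet hK),
    law_at kH x B = law_at kA x ((fun y => G (x, y)) @^-1` B)}.
  have : {ae distribution P X, forall x, forall I : {set alphabet hK * alphabet hK},
      kH x [set` I] = kA x ((fun y => G (x, y)) @^-1` [set` I])}.
    apply: filter_forall => I.
    apply: (regular_cond_law_map (Y := Y) kA_cond mG kH_G).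
    exact: measurable_alphabetX.
  apply: filterS => x kHx B; have := kHx (finset (mem B)).
  by rewrite (_ : [set` _] = B)//; apply/seteqP; split=> z /=; rewrite !inE.
apply: filterS kHE => x kHx.
set Pe := fine _; set HA := shannon_entropy _ => /=.
have fano : (HA - binary_entropy Pe - Pe * ln (#|K|%:R - 1))%:E <=
    mutual_information (law_at kH x) by exact: fano_mutual_information.
split=> //.
(* For fixed [x], the same map [gx] acts on both coordinates, so [kH x] is a coordinatewise image of
   [kA x]. *)
- have mgx : measurable_fun setT (fun a => g (a, x)).
    by apply: (measurableT_comp mg); exact: pair2_measurable.
  pose gx := mfun_Sub (mem_set mgx : (fun a => g (a, x)) \in mfun).
  apply: (@mutual_information_image _ _ _ _ _ _ _ _ _
    (index_enum (alphabet hK * alphabet hK)%type) gx gx) => // B.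
    exact: measurable_alphabetX.
  by rewrite mem_index_enum.
(* Since [Pe >= 0], the larger logarithm is subtracted with a non-negative coefficient; [#|K| >= 2]
   keeps both arguments of [ln] positive. *)
- apply: le_trans fano; rewrite lee_fin lerD2l lerN2 ler_wpM2l ?fine_ge0//.
  have K1 : (0 < #|K|%:R - 1 :> R)%R by rewrite subr_gt0 ltr1n.
  by rewrite ler_ln ?posrE// ?gerBl// (lt_trans K1)// gtrBl.
Qed.
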